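(* Let $K$ be a quadratic field with embeddings into $\mathbb{R}$ and $\mathbb{Q}_2$, and let $\alpha\in K\setminus\mathbb{Q}$ have property $I$. With $a_n(\alpha)$, $p'_n$, $q'_n$ and $\tau$ as defined in the context, there exists a constant $C>0$ such that for all $n\in\mathbb{Z}_{>0}$, $$\frac{C}{|q'_n|^{2}}<\left|\alpha_\infty-\frac{p'_n}{q'_n}\right|\left|\alpha_{\langle 2\rangle}-\frac{p'_n}{q'_n}\right|_2<\frac{2}{(1+\tau(n))\,|a_{n+1}(\alpha)|_2\,|q'_n|^2}.$$
   Context: $K$ is a quadratic field with fixed field embeddings $\sigma_\infty:K\to\mathbb{R}$ and $\sigma_2:K\to\mathbb{Q}_2$. For $\alpha\in K$ write $\alpha_\infty=\sigma_\infty(\alpha)$, $\alpha_{\langle 2\rangle}=\sigma_2(\alpha)$. $v_2$ is the $2$-adic valuation and $|u|_2=2^{-v_2(u)}$; $|\cdot|$ is the real absolute value. For $u=\sum_{n}c_n2^n\in\mathbb{Q}_2$ with digits $c_n\in\{0,1\}$ ($c_n=0$ for $n<v_2(u)$), put $\lfloor u\rfloor_2=\sum_{n\le 0}c_n2^n\in\mathbb{Z}[1/2]$. Put $\tau(n)=0$ if $n$ is even, $\tau(n)=1$ if $n$ is odd. Property $I$: $\alpha_\infty\in(-1,1]$ and $v_2(\alpha_{\langle 2\rangle})>0$. For $\alpha\in K^\times$ let $a^{(0)}(\alpha)=2m+\lfloor(1/\alpha)_{\langle 2\rangle}\rfloor_2$, where $m$ is the smallest among the integers $i$ minimizing $|(1/\alpha)_\infty-2i-\lfloor(1/\alpha)_{\langle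 2\rangle}\rfloor_2|$; let $a^{(1)}(\alpha)=m'+\lfloor(1/\alpha)_{\langle 2\rangle}\rfloor_2$, where $m'$ is the smallest among the integers $i$ minimizing $|(1/\alpha)_\infty-i-\lfloor(1/\alpha)_{\langle 2\rangle}\rfloor_2|$. Put $T_{2,\epsilon}(\alpha)=\frac1\alpha-a^{(\epsilon)}(\alpha)$ for $\epsilon\in\{0,1\}$. Algorithm: $\alpha_{(1)}=\alpha$; for $n\ge1$, $a_n(\alpha)=a^{(\tau(n))}(\alpha_{(n)})$ and $\alpha_{(n+1)}=T_{2,\tau(n)}(\alpha_{(n)})$ (for $\alpha\in K\setminus\mathbb{Q}$ the algorithm never terminates). Convergents: $p_0=0$, $q_0=1$, and for $n\ge1$ $$\begin{pmatrix} p_{n-1} & p_n \\ q_{n-1} & q_n \end{pmatrix}=\begin{pmatrix} 0 & 1 \\ 1 & a_1(\alpha) \end{pmatrix}\cdots\begin{pmatrix} 0 & 1 \\ 1 & a_n(\alpha) \end{pmatrix};$$ $p_n,q_n\in\mathbb{Z}[1/2]$ and $q_n\ne0$. For $n\ge1$ put $p'_n=2^{-\sum_{s=1}^n v_2(a_s(\alpha))}p_n$ and $q'_n=2^{-\sum_{s=1}^n v_2(a_s(\alpha))}q_n$; these are coprime integers with $p'_n/q'_n=p_n/q_n$. *)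

(* Defs.v *)
From HB Require Import structures.
From mathcomp Require Import all_boot all_order all_algebra all_solvable all_field.
From mathcomp Require Import boolp classical_sets reals.
From mathcomp Require Import lra.
Set Implicit Arguments.
Unset Strict Implicit.
Unset Printing Implicit Defensive.
Import Order.TTheory GRing.Theory Num.Theory.
Local Open Scope ring_scope.

(* A 2-adic integer is identified with its sequence of binary digits. *)
Record Z2 := MkZ2 { z2digit : nat -> bool }.

HB.instance Definition _ := gen_eqMixin Z2.
HB.instance Definition _ := gen_choiceMixin Z2.

(* The residue modulo 2 ^ n, as a natural number below 2 ^ n. *)
Definition z2trunc (x : Z2) (n : nat) : nat :=
  (\sum_(i < n) z2digit x i * 2 ^ i)%N.

(* The 2-adic integer congruent to s n modulo 2 ^ n for all n, for a sequence s
   with s n.+1 = s n %[mod 2 ^ n] for all n. *)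
Definition z2lim (s : nat -> nat) : Z2 :=
  MkZ2 (fun n => odd (s n.+1 %/ 2 ^ n)).

Definition z2coherent (s : nat -> nat) : Prop :=
  forall n, s n.+1 = s n %[mod 2 ^ n].

Lemma z2truncS x n : z2trunc x n.+1 = (z2trunc x n + z2digit x n * 2 ^ n)%N.
Proof. by rewrite /z2trunc big_ord_recr. Qed.

Lemma z2trunc0 x : z2trunc x 0 = 0%N.
Proof. by rewrite /z2trunc big_ord0. Qed.

Lemma z2trunc_lt x n : (z2trunc x n < 2 ^ n)%N.
Proof.
elim: n => [|n IHn]; first by rewrite z2trunc0.
rewrite z2truncS expnS mul2n -addnn -addSn leq_add //.
by case: (z2digit x n); rewrite ?mul1n ?mul0n.
Qed.

Lemma z2trunc_mod x n : (z2trunc x n %% 2 ^ n)%N = z2trunc x n.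
Proof. exact: modn_small (z2trunc_lt x n). Qed.

Lemma z2trunc_coherent x : z2coherent (z2trunc x).
Proof. by move=> n; rewrite z2truncS addnC modnMDl. Qed.

Lemma z2trunc_inj x y : (forall n, z2trunc x n = z2trunc y n) -> x = y.
Proof.
case: x y => [c] [d] eqt; congr MkZ2; apply/funext => n.
have := eqt n.+1; rewrite !z2truncS eqt => /addnI/eqP.
by rewrite eqn_pmul2r ?expn_gt0 //= => /eqP; case: (c n); case: (d n).
Qed.

Lemma z2trunc_lim s n : z2coherent s -> z2trunc (z2lim s) n = (s n %% 2 ^ n)%N.
Proof.
move=> coh; elim: n => [|n IHn]; first by rewrite z2trunc0 modn1.
rewrite z2truncS IHn -coh /= -modn2.
have p0 : (0 < 2 ^ n)%N by rewrite expn_gt0.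
rewrite [in RHS](divn_eq (s n.+1) (2 ^ n)).
move: (s n.+1 %/ 2 ^ n)%N (s n.+1 %% 2 ^ n)%N (ltn_pmod (s n.+1) p0) => q r lt_r.
rewrite [in RHS](divn_eq q 2) mulnDl -mulnA -expnS -addnA modnMDl.
rewrite [in RHS]modn_small; first by rewrite addnC.
have := ltn_pmod q (isT : 0 < 2)%N.
case: (q %% 2)%N => [|[|//]] _; rewrite expnS mul2n -addnn ?mul0n ?mul1n.
  by rewrite add0n (leq_trans lt_r) // leq_addr.
by rewrite ltn_add2l.
Qed.

Definition z2zero : Z2 := MkZ2 (fun=> false).
Definition z2one : Z2 := MkZ2 (fun n => n == 0%N).
Definition z2add (x y : Z2) : Z2 := z2lim (fun n => z2trunc x n + z2trunc y n)%N.
Definition z2opp (x : Z2) : Z2 := z2lim (fun n => 2 ^ n - z2trunc x n)%N.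
Definition z2mul (x y : Z2) : Z2 := z2lim (fun n => z2trunc x n * z2trunc y n)%N.
Definition z2unit : pred Z2 := fun x => z2digit x 0.
(* The inverse modulo 2 ^ n comes from Euler's theorem. *)
Definition z2inv (x : Z2) : Z2 :=
  if z2digit x 0 then z2lim (fun n => z2trunc x n ^ (totient (2 ^ n)).-1)%N
  else x.

Lemma z2trunc_zero n : z2trunc z2zero n = 0%N.
Proof. by rewrite /z2trunc big1. Qed.

Lemma z2trunc_one n : z2trunc z2one n = (1 %% 2 ^ n)%N.
Proof.
case: n => [|n]; first by rewrite z2trunc0 modn1.
rewrite /z2trunc big_ord_recl big1 //= addn0 modn_small //.
by rewrite -[X in (X < _)%N](expn0 2) ltn_exp2l.
Qed.

Lemma z2trunc_add x y n :
  z2trunc (z2add x y) n = ((z2trunc x n + z2trunc y n) %% 2 ^ n)%N.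
Proof.
rewrite z2trunc_lim // => {}n.
by rewrite -modnDm !z2trunc_coherent modnDm.
Qed.

Lemma z2trunc_mul x y n :
  z2trunc (z2mul x y) n = ((z2trunc x n * z2trunc y n) %% 2 ^ n)%N.
Proof.
rewrite z2trunc_lim // => {}n.
by rewrite -modnMm !z2trunc_coherent modnMm.
Qed.

Lemma z2trunc_opp x n :
  z2trunc (z2opp x) n = ((2 ^ n - z2trunc x n) %% 2 ^ n)%N.
Proof.
rewrite z2trunc_lim // => {}n.
apply/eqP; rewrite -(eqn_modDr (z2trunc x n.+1)) subnK ?(ltnW (z2trunc_lt _ _)) //.
rewrite -[X in _ == X]modnDmr z2trunc_coherent modnDmr.
rewrite subnK ?(ltnW (z2trunc_lt _ _)) //.
by rewrite modnn expnS modnMl.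
Qed.

Lemma z2trunc_coprime x n : z2digit x 0 -> coprime (z2trunc x n) (2 ^ n).
Proof.
move=> x0; case: n => [|n]; first by rewrite expn0 coprimen1.
rewrite coprimeXr // coprimen2; elim: n => [|n IHn]; rewrite z2truncS.
  by rewrite z2trunc0 x0.
by rewrite oddD IHn oddM oddX /= andbF.
Qed.

Lemma z2trunc_inv x n : z2digit x 0 ->
  (z2trunc (z2inv x) n * z2trunc x n = 1 %[mod 2 ^ n])%N.
Proof.
move=> x0.
have inv m : (z2trunc x m ^ (totient (2 ^ m)).-1 * z2trunc x m
              = 1 %[mod 2 ^ m])%N.
  rewrite -expnSr prednK ?totient_gt0 ?expn_gt0 //.
  exact: Euler_exp_totient (z2trunc_coprime _ x0).
rewrite /z2inv x0 z2trunc_lim ?modnMml ?inv // => {}n.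
set u := (_ ^ _)%N; set w := (_ ^ _)%N.
have uE : (u * z2trunc x n = 1 %[mod 2 ^ n])%N.
  rewrite -modnMmr -z2trunc_coherent modnMmr -(modn_dvdm _ (dvdn_exp2l 2 (leqnSn n))).
  by rewrite inv modn_dvdm ?dvdn_exp2l.
rewrite -[u]muln1 -modnMmr -(inv n) modnMmr mulnCA -modnMmr uE.
by rewrite modnMmr muln1.
Qed.

Fact z2addA : associative z2add.
Proof.
move=> x y z; apply: z2trunc_inj => n.
by rewrite !z2trunc_add modnDmr modnDml addnA.
Qed.

Fact z2addC : commutative z2add.
Proof. by move=> x y; apply: z2trunc_inj => n; rewrite !z2trunc_add addnC. Qed.

Fact z2add0 : left_id z2zero z2add.
Proof.
by move=> x; apply: z2trunc_inj => n; rewrite z2trunc_add z2trunc_zero z2trunc_mod.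
Qed.

Fact z2addN : left_inverse z2zero z2opp z2add.
Proof.
move=> x; apply: z2trunc_inj => n; rewrite z2trunc_add z2trunc_opp z2trunc_zero.
by rewrite modnDml subnK ?modnn // ltnW // z2trunc_lt.
Qed.

HB.instance Definition _ := GRing.isZmodule.Build Z2 z2addA z2addC z2add0 z2addN.

Fact z2mulA : associative z2mul.
Proof.
move=> x y z; apply: z2trunc_inj => n.
by rewrite !z2trunc_mul modnMmr modnMml mulnA.
Qed.

Fact z2mulC : commutative z2mul.
Proof. by move=> x y; apply: z2trunc_inj => n; rewrite !z2trunc_mul mulnC. Qed.

Fact z2mul1 : left_id z2one z2mul.
Proof.
move=> x; apply: z2trunc_inj => n.
by rewrite z2trunc_mul z2trunc_one modnMml mul1n z2trunc_mod.
Qed.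

Fact z2mulDl : left_distributive z2mul z2add.
Proof.
move=> x y z; apply: z2trunc_inj => n.
rewrite z2trunc_mul !z2trunc_add !z2trunc_mul.
by rewrite modnMml modnDm mulnDl.
Qed.

Fact z2one_neq0 : z2one != z2zero.
Proof. by apply/eqP => /(congr1 (z2digit^~ 0%N)). Qed.

HB.instance Definition _ :=
  GRing.Zmodule_isComNzRing.Build Z2 z2mulA z2mulC z2mul1 z2mulDl z2one_neq0.

Fact z2mulV : {in z2unit, left_inverse 1 z2inv *%R}.
Proof.
move=> x x0; apply: z2trunc_inj => n.
by rewrite z2trunc_mul z2trunc_inv // -z2trunc_one.
Qed.

Fact z2unitP (x y : Z2) : y * x = 1 -> z2unit x.
Proof.
move=> /(congr1 (z2trunc^~ 1%N)).
rewrite z2trunc_mul z2trunc_one !z2truncS !z2trunc0 /z2unit.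
by case: (z2digit x 0) => //; rewrite muln0.
Qed.

Fact z2inv_out : {in [predC z2unit], z2inv =1 id}.
Proof.
by move=> x; rewrite inE /= /z2inv unfold_in => /negPf; rewrite /z2unit => ->.
Qed.

HB.instance Definition _ :=
  GRing.ComNzRing_hasMulInverse.Build Z2 z2mulV z2unitP z2inv_out.

(* The 2-adic valuation of a 2-adic integer, with the dummy value 0 at 0. *)
Definition z2val (x : Z2) : nat :=
  if pselect (exists i, z2digit x i) is left h then ex_minn h else 0%N.

Definition z2shift (k : nat) (x : Z2) : Z2 := MkZ2 (fun i => z2digit x (i + k)).

Lemma z2trunc_nat m n : z2trunc m%:R n = (m %% 2 ^ n)%N.
Proof.
elim: m => [|m IHm]; first by rewrite z2trunc_zero mod0n.
by rewrite -addn1 natrD z2trunc_add IHm z2trunc_one modnDm.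
Qed.

Lemma z2trunc_exp2 k n : z2trunc (2%:R ^+ k) n = (2 ^ k %% 2 ^ n)%N.
Proof. by rewrite -natrX z2trunc_nat. Qed.

Lemma z2trunc_le x m n : (m <= n)%N -> z2trunc x n = z2trunc x m %[mod 2 ^ m].
Proof.
move=> le_mn; rewrite -(subnK le_mn); elim: (n - m)%N => [//|d IHd].
rewrite addSn -[RHS]IHd -(modn_dvdm _ (dvdn_exp2l 2 (leq_addl d m))).
by rewrite z2trunc_coherent modn_dvdm // dvdn_exp2l // leq_addl.
Qed.

Lemma z2trunc_shift x k n :
  z2trunc x (n + k) = (z2trunc x k + 2 ^ k * z2trunc (z2shift k x) n)%N.
Proof.
elim: n => [|n IHn]; first by rewrite z2trunc0 muln0 addn0.
rewrite addSn !z2truncS IHn mulnDr -addnA /= expnD.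
by rewrite [(_ * (2 ^ n * _))%N]mulnA [(2 ^ k * (_ * 2 ^ n))%N]mulnC.
Qed.

Lemma z2shiftE x k : (forall i, (i < k)%N -> z2digit x i = false) ->
  x = 2%:R ^+ k * z2shift k x.
Proof.
move=> lo; apply: z2trunc_inj => n; rewrite z2trunc_mul z2trunc_exp2 modnMml.
rewrite -z2trunc_mod -(z2trunc_le x (leq_addr k n)) z2trunc_shift.
by rewrite [z2trunc x k]big1 // => i _; rewrite lo.
Qed.

Lemma z2valE x : x != 0 -> x = 2%:R ^+ z2val x * z2shift (z2val x) x.
Proof.
move=> x_neq0; apply: z2shiftE => i; rewrite /z2val; case: pselect => // h.
by case: ex_minnP => v _ minv lt_iv; apply: contraTF lt_iv => /minv; rewrite leqNgt.
Qed.

Lemma z2val_unit x : x != 0 -> z2shift (z2val x) x \is a GRing.unit.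
Proof.
move=> /eqP x_neq0; rewrite -topredE /= /z2unit /= /z2val; case: pselect => [h|h].
  by case: ex_minnP.
case: x_neq0; apply: z2trunc_inj => n.
rewrite z2trunc_zero [LHS]big1 // => i _.
case xi: (z2digit x i); last by rewrite mul0n.
by case: h; exists i.
Qed.

Lemma z2exp2_neq0 k : 2%:R ^+ k != 0 :> Z2.
Proof.
apply/eqP => /(congr1 (z2trunc^~ k.+1)); rewrite z2trunc_exp2 z2trunc_zero.
by rewrite modn_small ?ltn_exp2l // => /eqP; rewrite expn_eq0.
Qed.

Fact z2mul_eq0 (x y : Z2) : x * y = 0 -> (x == 0) || (y == 0).
Proof.
move=> xy0; apply/orP; have [_|x_neq0] := eqVneq x 0; first by left.
have [_|y_neq0] := eqVneq y 0; first by right.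
have /eqP[] := z2exp2_neq0 (z2val x + z2val y).
have Ux := z2val_unit x_neq0; have Uy := z2val_unit y_neq0.
apply: (mulIr (_ : z2shift (z2val x) x * z2shift (z2val y) y \is a GRing.unit)).
  by rewrite unitrM Ux Uy.
by rewrite mul0r exprD mulrACA -(z2valE x_neq0) -(z2valE y_neq0).
Qed.

HB.instance Definition _ := GRing.ComUnitRing_isIntegral.Build Z2 z2mul_eq0.

Notation Q2 := {fraction Z2}.

Notation "x %:F" := (@tofrac Z2 x) : ring_scope.

(* The 2-adic valuation on Q_2, with the dummy value 0 at 0. *)
Definition v2 (u : Q2) : int :=
  if u == 0 then 0 else (z2val (repr u).1)%:Z - (z2val (repr u).2)%:Z.

(* The 2-adic absolute value, with values in any field of numbers. *)
Definition norm2 {F : numFieldType} (u : Q2) : F :=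
  if u == 0 then 0 else 2%:R ^ (- v2 u).

Lemma z2unitE (x : Z2) : (x \is a GRing.unit) = z2digit x 0.
Proof. by []. Qed.

Lemma z2unit_exp2M k (x : Z2) : 2%:R ^+ k * x \is a GRing.unit -> k = 0%N.
Proof.
case: k => // k U; have : z2trunc (2%:R ^+ k.+1 * x) 1 = 1%N.
  by rewrite z2truncS z2trunc0 -z2unitE U.
by rewrite z2trunc_mul z2trunc_exp2 expnS -modnMml modn_mod modnMr.
Qed.

Lemma z2val_exp2M k (x : Z2) :
  x \is a GRing.unit -> z2val (2%:R ^+ k * x) = k.
Proof.
move=> Ux; set y := _ * x.
have y_neq0 : y != 0.
  rewrite mulf_neq0 ?z2exp2_neq0 //.
  by apply: contraTneq Ux => ->; rewrite unitr0.
have := z2valE y_neq0; have := z2val_unit y_neq0.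
move: (z2shift _ y) => w Uw; rewrite {1}/y.
have [lt_vk|lt_kv|//] := ltngtP (z2val y) k.
  rewrite -(subnK (ltnW lt_vk)) addnC exprD -mulrA => /(mulfI (z2exp2_neq0 _)) E.
  by move: Uw; rewrite -E => /z2unit_exp2M /eqP; rewrite subn_eq0 leqNgt lt_vk.
rewrite -{1}(subnK (ltnW lt_kv)) addnC exprD -mulrA => /(mulfI (z2exp2_neq0 _)) E.
by move: Ux; rewrite E => /z2unit_exp2M /eqP; rewrite subn_eq0 leqNgt lt_kv.
Qed.

Lemma z2val_exp2 k : z2val (2%:R ^+ k) = k.
Proof. by rewrite -[2%:R ^+ k]mulr1 z2val_exp2M ?unitr1. Qed.

Lemma z2valM (x y : Z2) :
  x != 0 -> y != 0 -> z2val (x * y) = (z2val x + z2val y)%N.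
Proof.
move=> x0 y0; rewrite {1}(z2valE x0) {1}(z2valE y0) mulrACA -exprD.
by rewrite z2val_exp2M // unitrM !z2val_unit.
Qed.

Lemma Q2_repr (u : Q2) : u * ((repr u).2)%:F = ((repr u).1)%:F.
Proof.
have d0 := denom_ratioP (repr u).
rewrite -{1}[u]reprK; move: (repr u) d0 => r d0.
rewrite /GRing.mul /= !piE; apply/eqmodP => /=.
rewrite /FracField.mulf FracField.equivfE.
by rewrite !numden_Ratio ?mulf_neq0 ?oner_eq0 // !mulr1 mulrC.
Qed.

Lemma v2_frac (x y : Z2) :
  x != 0 -> y != 0 -> v2 (x%:F / y%:F) = (z2val x)%:Z - (z2val y)%:Z.
Proof.
move=> x0 y0; set u := _ / _.
have u0 : u != 0 by rewrite mulf_neq0 ?invr_eq0 ?tofrac_eq0.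
have d0 := denom_ratioP (repr u); have E := Q2_repr u.
have n0 : (repr u).1 != 0 by rewrite -tofrac_eq0 -E mulf_neq0 ?tofrac_eq0.
rewrite /v2 (negPf u0).
have : x * (repr u).2 = (repr u).1 * y.
  apply/eqP; rewrite -tofrac_eq !tofracM -E mulrAC /u divfK ?tofrac_eq0 //.
move/(congr1 z2val); rewrite !z2valM // => /(congr1 Posz); rewrite !PoszD => H.
by apply/eqP; rewrite subr_eq addrAC eq_sym subr_eq H.
Qed.

Lemma Q2_two : (2%:R : Q2) = (2%:R : Z2)%:F.
Proof. by rewrite rmorph_nat. Qed.

Lemma v2_exp2M (k : int) (x : Z2) :
  x != 0 -> v2 (2%:R ^ k * x%:F) = k + (z2val x)%:Z.
Proof.
move=> x0; rewrite Q2_two; case: k => k.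
  rewrite /exprz -tofracXn -tofracM -[_%:F]divr1 -tofrac1 v2_frac ?oner_eq0 //.
    by rewrite z2valM ?z2exp2_neq0 // z2val_exp2 -[1](expr0 2%:R) z2val_exp2 subr0.
  by rewrite mulf_neq0 ?z2exp2_neq0.
rewrite NegzE -exprz_inv /exprz exprVn mulrC -tofracXn v2_frac ?z2exp2_neq0 //.
by rewrite z2val_exp2 addrC.
Qed.

Lemma Q2_two_neq0 : (2%:R : Q2) != 0.
Proof. by rewrite Q2_two tofrac_eq0 -[2%:R]expr1 z2exp2_neq0. Qed.

Lemma Q2_decomp (u : Q2) : u != 0 -> exists x : Z2, u = 2%:R ^ v2 u * x%:F.
Proof.
move=> u0; have d0 := denom_ratioP (repr u); have E := Q2_repr u.
have n0 : (repr u).1 != 0 by rewrite -tofrac_eq0 -E mulf_neq0 ?tofrac_eq0.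
rewrite /v2 (negPf u0); move: (repr u).1 (repr u).2 d0 n0 E => n d d0 n0 E.
have := z2valE n0; have := z2valE d0; have := z2val_unit d0.
move: (z2val n) (z2val d) (z2shift _ n) (z2shift _ d) => i j a b Ub dE nE.
exists (a * b^-1); apply: (mulIf (_ : d%:F != 0)); first by rewrite tofrac_eq0.
rewrite E -mulrA -tofracM {1}dE mulrACA [a * _]mulrC -mulrA mulVr // mulr1.
rewrite mulrC tofracM nE tofracM !tofracXn -Q2_two mulrAC.
by rewrite !exprnP -expfzDr ?Q2_two_neq0 // addrC subrK.
Qed.

Lemma z2splitE (x : Z2) (k : nat) :
  x = (z2trunc x k)%:R + 2%:R ^+ k * z2shift k x.
Proof.
apply: z2trunc_inj => n; rewrite z2trunc_add z2trunc_nat z2trunc_mul z2trunc_exp2.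
rewrite modnMml modnDm -z2trunc_shift (z2trunc_le x (leq_addr k n)).
by rewrite z2trunc_mod.
Qed.

(* u = \sum_(n >= v2 u) c n 2 ^ n, the series being 2-adically convergent, and
   c n = 0 for n < v2 u. *)
Definition is_digits (u : Q2) (c : int -> bool) : Prop :=
  (forall n, n < v2 u -> c n = false) /\
  (forall e : rat, 0 < e -> exists N0 : nat, forall N : nat, (N0 <= N)%N ->
     norm2 (u - \sum_(j < N) (c (v2 u + j%:Z))%:R * 2%:R ^ (v2 u + j%:Z)) < e).

Lemma digits_exist (u : Q2) : exists c, is_digits u c.
Proof.
have [->|u0] := eqVneq u 0.
  exists (fun=> false); split=> // e e0; exists 0%N => N _.
  by rewrite big1 ?subr0 ?/norm2 ?eqxx // => j _; rewrite mul0r.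
have [x uE] := Q2_decomp u0; set v := v2 u in uE *.
pose c (n : int) : bool := (v <= n) && z2digit x `|n - v|%N.
exists c; split=> [n|e e0]; first by rewrite -/v /c ltNge => /negPf->.
have [N0 ltN0] : exists N0 : nat, 2%:R ^ (- (v + N0%:Z)) < e.
  exists (Num.bound (2%:R ^ (- v) / e)).
  have b0 : 0 <= 2%:R ^ (- v) / e by rewrite divr_ge0 ?exprz_ge0 // ltW.
  rewrite opprD expfzDr // -[2%:R ^ (- (_ : nat)%:Z)]invr_expz -exprnP.
  rewrite ltr_pdivrMr ?exprn_gt0 // mulrC -ltr_pdivrMr // (lt_le_trans (archi_boundP b0)) //.
  by rewrite -natrX ler_nat ltnW // ltn_expl.
exists N0 => N leN; rewrite -/v.
have -> : \sum_(j < N) (c (v + j%:Z))%:R * 2%:R ^ (v + j%:Z)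
     = 2%:R ^ v * (z2trunc x N)%:R :> Q2.
  rewrite /z2trunc natr_sum mulr_sumr; apply: eq_bigr => j _.
  rewrite /c lerDl le0z_nat [v + _]addrC addrK absz_nat addrC expfzDr ?Q2_two_neq0 //.
  by rewrite natrM natrX exprnP mulrCA.
have xE : x - (z2trunc x N)%:R = 2%:R ^+ N * z2shift N x.
  by rewrite {1}(z2splitE x N) addrC addKr.
rewrite uE -mulrBr -[(z2trunc x N)%:R](rmorph_nat (@tofrac Z2)) -tofracB xE tofracM tofracXn -Q2_two.
rewrite mulrA exprnP -expfzDr ?Q2_two_neq0 //.
have [->|w0] := eqVneq (z2shift N x) 0.
  by rewrite tofrac0 mulr0 /norm2 eqxx.
rewrite /norm2 mulf_eq0 expfz_eq0 (negPf Q2_two_neq0) andbF tofrac_eq0 (negPf w0).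
rewrite v2_exp2M //; apply: le_lt_trans ltN0.
by rewrite ler_weXz2l ?ler1n // lerN2 -addrA lerD2l -PoszD lez_nat (leq_trans leN) ?leq_addr.
Qed.

Definition digits (u : Q2) : int -> bool := sval (cid (digits_exist u)).

Lemma digitsP (u : Q2) : is_digits u (digits u).
Proof. by rewrite /digits; case: cid. Qed.

(* The sum of digits u n * 2 ^ n over n <= 0; the terms with n < - `|v2 u|
   vanish. *)
Definition floor2 (u : Q2) : rat :=
  \sum_(k < `|v2 u|.+1) (digits u (- k%:Z))%:R * 2%:R ^ (- k%:Z).

(* m is the smallest of the integers minimizing f. *)
Definition is_least_argmin (R : realType) (f : int -> R) (m : int) : Prop :=
  (forall i, f m <= f i) /\ (forall j, (forall i, f j <= f i) -> m <= j).

Definition least_argmin (R : realType) (f : int -> R) : int :=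
  xget 0 [set m | is_least_argmin f m].

Lemma least_argminP (R : realType) (x d y : R) : 0 < d ->
  let f (i : int) := `|x - d * i%:~R - y| in is_least_argmin f (least_argmin f).
Proof.
move=> d0 f; rewrite /least_argmin.
suff [m fm] : exists m, is_least_argmin f m by case: xgetP => [_ -> //|/(_ m)].
pose t := (x - y) / d.
have fE i : f i = d * `|t - i%:~R|.
  rewrite -[X in X * _](gtr0_norm d0) -normrM mulrBr /t mulrC divfK ?gt_eqF //.
  by rewrite /f addrAC.
pose m := Num.ceil (t - 2%:R^-1).
have [ltm lem] : m%:~R - 1 < t - 2%:R^-1 /\ t - 2%:R^-1 <= m%:~R.
  by have /andP[] := ceil_itv (t - 2%:R^-1); rewrite -/m intrB => -> ->.
have nb : `|t - m%:~R| <= 2%:R^-1 by rewrite ler_norml; lra.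
have below i : i < m -> `|t - m%:~R| < `|t - i%:~R|.
  rewrite -lezD1 => lt_im; have : (i + 1)%:~R <= m%:~R :> R by rewrite ler_int.
  rewrite intrD => h; apply: le_lt_trans nb _; rewrite ltr_normr; lra.
exists m; split=> [i|j minj].
  rewrite !fE ler_pM2l //; have [/below/ltW //|] := ltP i m.
  rewrite le_eqVlt => /predU1P[-> //|]; rewrite -lezD1 => lt_mi.
  have : (m + 1)%:~R <= i%:~R :> R by rewrite ler_int.
  rewrite intrD => h; apply: le_trans nb _; rewrite ler_normr; lra.
by rewrite leNgt; apply/negP => /below; rewrite -(ltr_pM2l d0) -!fE ltNge minj.
Qed.

Definition tau (n : nat) : nat := odd n.

Definition propertyI (R : realType) (K : fieldExtType rat)
    (soo : {rmorphism K -> R}) (s2 : {rmorphism K -> Q2}) (x : K) : Prop :=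
  -1 < soo x <= 1 /\ 0 < v2 (s2 x).

Definition quot0 (R : realType) (K : fieldExtType rat)
    (soo : {rmorphism K -> R}) (s2 : {rmorphism K -> Q2}) (x : K) : rat :=
  let y := floor2 (s2 x^-1) in
  let m := least_argmin (fun i => `|soo x^-1 - 2%:R * i%:~R - ratr y|) in
  2%:R * m%:~R + y.

Definition quot1 (R : realType) (K : fieldExtType rat)
    (soo : {rmorphism K -> R}) (s2 : {rmorphism K -> Q2}) (x : K) : rat :=
  let y := floor2 (s2 x^-1) in
  let m := least_argmin (fun i => `|soo x^-1 - i%:~R - ratr y|) in
  m%:~R + y.

Definition quot (R : realType) (K : fieldExtType rat)
    (soo : {rmorphism K -> R}) (s2 : {rmorphism K -> Q2})
    (eps : nat) (x : K) : rat :=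
  if eps == 0%N then quot0 soo s2 x else quot1 soo s2 x.

Definition T2 (R : realType) (K : fieldExtType rat)
    (soo : {rmorphism K -> R}) (s2 : {rmorphism K -> Q2})
    (eps : nat) (x : K) : K :=
  x^-1 - ratr (quot soo s2 eps x).

(* The sequence starts at index 1; the value at 0 is a dummy. *)
Fixpoint cf_tail (R : realType) (K : fieldExtType rat)
    (soo : {rmorphism K -> R}) (s2 : {rmorphism K -> Q2})
    (x : K) (n : nat) : K :=
  match n with
  | 0 => x
  | n'.+1 => if n' == 0%N then x
             else T2 soo s2 (tau n') (cf_tail soo s2 x n')
  end.

Definition cf_quot (R : realType) (K : fieldExtType rat)
    (soo : {rmorphism K -> R}) (s2 : {rmorphism K -> Q2})
    (x : K) (n : nat) : rat :=
  quot soo s2 (tau n) (cf_tail soo s2 x n).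

Definition cf_mx (c : rat) : 'M[rat]_2 :=
  \matrix_(i, j) nth 0 (nth [::] [:: [:: 0; 1]; [:: 1; c]] i) j.

Definition conv_mx (a : nat -> rat) (n : nat) : 'M[rat]_2 :=
  \prod_(1 <= k < n.+1) cf_mx (a k).

Definition conv_p (a : nat -> rat) (n : nat) : rat := conv_mx a n 0 1.
Definition conv_q (a : nat -> rat) (n : nat) : rat := conv_mx a n 1 1.

Lemma conv_p0 a : conv_p a 0 = 0.
Proof. by rewrite /conv_p /conv_mx big_geq // mxE. Qed.

Lemma conv_q0 a : conv_q a 0 = 1.
Proof. by rewrite /conv_q /conv_mx big_geq // mxE. Qed.

Lemma conv_mxE a n : (0 < n)%N ->
  conv_mx a n = \matrix_(i, j)
    nth 0 (nth [::] [:: [:: conv_p a n.-1; conv_p a n];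
                        [:: conv_q a n.-1; conv_q a n]] i) j.
Proof.
case: n => // n _; have col0 i : conv_mx a n.+1 i 0 = conv_mx a n i 1.
  rewrite {1}/conv_mx big_nat_recr //= -/(conv_mx a n) mxE !big_ord_recl big_ord0.
  rewrite !mxE /= mulr0 mulr1 add0r addr0.
  by congr (conv_mx a n _ _); apply: val_inj.
have ord2 (i : 'I_2) : i = 0 \/ i = 1.
  by case: i => [[|[|//]] lti]; [left | right]; apply: val_inj.
by apply/matrixP => i j; rewrite mxE; case: (ord2 i) (ord2 j) => -> [] ->;
  rewrite /= ?col0.
Qed.

Definition conv_scale (a : nat -> rat) (n : nat) : rat :=
  2%:R ^ (- \sum_(1 <= s < n.+1) v2 (ratr (a s))).

Definition conv_p' (a : nat -> rat) (n : nat) : rat := conv_scale a n * conv_p a n.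
Definition conv_q' (a : nat -> rat) (n : nat) : rat := conv_scale a n * conv_q a n.

(* Main.v *)
(* Write x_n for the n-th complete quotient alpha_(n), and put
   Q_n = q_n + q_(n-1) x_(n+1), so that Q_n = Q_(n+1) x_(n+1), Q_0 = 1 and
   p_n - alpha q_n = +-1 / Q_(n+1).  Hence
     |alpha - p_n/q_n|_oo = 1 / |q_n Q_(n+1)|,
     |alpha - p_n/q_n|_2 = 1 / (|a_(n+1)|_2 |q_n|_2^2),
   the second because |a_n|_2 |x_n|_2 = 1 and |q_n|_2 = |a_1|_2 ... |a_n|_2, the
   recurrence for q_n being dominated 2-adically by its first term.  Since
   |q'_n| = |q_n| |q_n|_2, the upper bound amounts to
   (1 + tau n) |q_n| < 2 |Q_(n+1)|, which follows by induction from
   q_n = Q_n - q_(n-1) x_(n+1) and (1 + tau n) |x_(n+1)| < 1.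

   The lower bound is Liouville's argument with respect to both places at once:
   if alpha^2 = b alpha + c with rational b, c, then p^2 - b p q - c q^2 is a
   nonzero element of Z[1/2] up to a bounded denominator, so the product of its
   real and 2-adic absolute values is bounded below, and it factors as
   q^2 (alpha - p/q) (b - alpha - p/q).  The conjugate factor is bounded once
   |alpha - p_n/q_n| <= 1 at both places; at the real place this requires the
   quantitative version of the inequality above, as |q_n| may be much smaller
   than |Q_(n+1)|. *)

Require Import Defs.
From HB Require Import structures.
From mathcomp Require Import all_boot all_order all_algebra all_solvable all_field.
From mathcomp Require Import boolp classical_sets reals.
From mathcomp Require Import ring lra zify.
Set Implicit Arguments.
Unset Strict Implicit.
Unset Printing Implicit Defensive.
Import Order.TTheory GRing.Theory Num.Theory.
Local Open Scope ring_scope.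

(** * The 2-adic absolute value *)

Section Norm2.
Variable F : numFieldType.
Implicit Types (u v : Q2) (x : Z2).
Local Notation N2 := (@norm2 F).

Lemma v2M u v : u != 0 -> v != 0 -> v2 (u * v) = v2 u + v2 v.
Proof.
move=> u0 v0; have [x ux] := Q2_decomp u0; have [y vy] := Q2_decomp v0.
have x0 : x != 0 by apply: contra_neq u0 => x0; rewrite ux x0 tofrac0 mulr0.
have y0 : y != 0 by apply: contra_neq v0 => y0; rewrite vy y0 tofrac0 mulr0.
have vu : v2 u = v2 u + (z2val x)%:Z by rewrite {1}ux v2_exp2M.
have vv : v2 v = v2 v + (z2val y)%:Z by rewrite {1}vy v2_exp2M.
rewrite {1}ux {1}vy mulrACA -expfzDr ?Q2_two_neq0 // -tofracM.
by rewrite v2_exp2M ?mulf_neq0 // z2valM // PoszD addrACA -vu -vv.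
Qed.

Lemma norm2_0 : N2 0 = 0.
Proof. by rewrite /norm2 eqxx. Qed.

Lemma norm2_gt0 u : (0 < N2 u) = (u != 0).
Proof.
by rewrite /norm2; case: eqP => _ /=; rewrite ?ltxx // exprz_gt0.
Qed.

Lemma norm2_ge0 u : 0 <= N2 u.
Proof.
by have [->|u0] := eqVneq u 0; rewrite ?norm2_0 // ltW // norm2_gt0.
Qed.

Lemma norm2_eq0 u : (N2 u == 0) = (u == 0).
Proof. by apply: negb_inj; rewrite -norm2_gt0 lt_def norm2_ge0 andbT. Qed.

Lemma norm2M u v : N2 (u * v) = N2 u * N2 v.
Proof.
have [->|u0] := eqVneq u 0; first by rewrite mul0r norm2_0 mul0r.
have [->|v0] := eqVneq v 0; first by rewrite mulr0 norm2_0 mulr0.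
rewrite /norm2 mulf_eq0 (negPf u0) (negPf v0) /= v2M // opprD expfzDr //.
by rewrite pnatr_eq0.
Qed.

Lemma norm2_exp2M (k : int) x : x != 0 ->
  N2 (2%:R ^ k * x%:F) = 2%:R ^ (- k - (z2val x)%:Z).
Proof.
move=> x0; rewrite /norm2 mulf_eq0 expfz_eq0 (negPf Q2_two_neq0) andbF.
by rewrite tofrac_eq0 (negPf x0) v2_exp2M // opprD.
Qed.

Lemma norm2_exp2 (k : int) : N2 (2%:R ^ k) = 2%:R ^ (- k).
Proof.
have := @norm2_exp2M k 1 (oner_neq0 _); rewrite tofrac1 mulr1 => ->.
by rewrite (z2val_exp2 0) subr0.
Qed.

Lemma norm2_two : N2 2%:R = 2%:R^-1.
Proof. by have := norm2_exp2 1; rewrite expr1z exprN1. Qed.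

Lemma norm2_1 : N2 1 = 1.
Proof. by have := norm2_exp2 0; rewrite expr0z. Qed.

Lemma norm2V u : N2 u^-1 = (N2 u)^-1.
Proof.
have [->|u0] := eqVneq u 0; first by rewrite invr0 norm2_0 invr0.
apply: (mulfI (_ : N2 u != 0)); first by rewrite norm2_eq0.
by rewrite -norm2M !mulfV ?norm2_1 ?norm2_eq0.
Qed.

Lemma norm2X u k : N2 (u ^+ k) = N2 u ^+ k.
Proof.
by elim: k => [|k IHk]; rewrite ?expr0 ?norm2_1 // !exprS norm2M IHk.
Qed.

Lemma norm2_tofrac_le1 x : N2 x%:F <= 1.
Proof.
have [->|x0] := eqVneq x 0; first by rewrite tofrac0 norm2_0.
rewrite -[x%:F]mul1r -(expr0z 2%:R) norm2_exp2M // oppr0 sub0r.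
by rewrite -invr_expz invf_le1 ?exprn_gt0 // exprn_ege1 // ler1n.
Qed.

Lemma norm2_le1P u : N2 u <= 1 -> exists x, u = x%:F.
Proof.
have [-> _|u0] := eqVneq u 0; first by exists 0; rewrite tofrac0.
rewrite /norm2 (negPf u0) => le1; have [x ux] := Q2_decomp u0.
case E: (v2 u) le1 ux => [k|k] le1 ->.
  by exists (2%:R ^+ k * x); rewrite tofracM tofracXn -Q2_two.
move: le1; rewrite NegzE opprK -exprnP => le1.
by rewrite lt_geF ?exprn_egt1 ?ltr1n in le1.
Qed.

Lemma norm2_int (m : int) : N2 m%:~R <= 1.
Proof. by rewrite -(rmorph_int (@tofrac Z2)) norm2_tofrac_le1. Qed.

Lemma norm2N u : N2 (- u) = N2 u.
Proof.
rewrite -mulN1r norm2M (_ : N2 (- 1) = 1) ?mul1r //.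
have /eqP : N2 (- 1) ^+ 2 = 1 ^+ 2 by rewrite -norm2X sqrrN !expr1n norm2_1.
by rewrite eqrXn2 ?norm2_ge0 ?ler01 // => /eqP.
Qed.

Lemma norm2D_le u v e : N2 u <= e -> N2 v <= e -> N2 (u + v) <= e.
Proof.
wlog suff main : u v / N2 v <= N2 u -> N2 (u + v) <= N2 u.
  move=> ue ve.
  have /orP[le|le] : (N2 v <= N2 u) || (N2 u <= N2 v).
  - by apply: ger_leVge; apply: norm2_ge0.
  - exact: le_trans (main _ _ le) ue.
  - by rewrite addrC; apply: le_trans (main _ _ le) ve.
have [->|u0] := eqVneq u 0.
  by rewrite norm2_0 => v0; rewrite add0r.
have Nu : 0 < N2 u by rewrite norm2_gt0.
move=> le.
have [x xE] : exists x, v / u = x%:F.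
  by apply: norm2_le1P; rewrite norm2M norm2V ler_pdivrMr // mul1r.
have -> : u + v = u * (1 + x)%:F by rewrite tofracD tofrac1 -xE mulrDr mulr1 mulrC divfK.
by rewrite norm2M ler_piMr ?norm2_tofrac_le1 // ltW.
Qed.

Lemma norm2B_le u v e : N2 u <= e -> N2 v <= e -> N2 (u - v) <= e.
Proof. by move=> ue ve; rewrite norm2D_le ?norm2N. Qed.

Lemma norm2D_eq u v : N2 v < N2 u -> N2 (u + v) = N2 u.
Proof.
move=> lt_vu; apply/le_anti; rewrite norm2D_le ?lexx ?(ltW lt_vu) //=.
have uE : N2 u = N2 (u + v - v) by rewrite addrK.
have /orP[le|le] := ger_leVge (norm2_ge0 (u + v)) (norm2_ge0 v).
  have : N2 u <= N2 v by rewrite uE norm2B_le.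
  by move=> /(lt_le_trans lt_vu); rewrite ltxx.
by rewrite uE norm2B_le.
Qed.

Lemma norm2_sum_le (I : Type) (r : seq I) (P : pred I) (f : I -> Q2) (e : F) :
  0 <= e -> (forall i, P i -> N2 (f i) <= e) -> N2 (\sum_(i <- r | P i) f i) <= e.
Proof.
move=> e0 fe; apply: (big_ind (fun u => N2 u <= e)) => //.
  by rewrite norm2_0.
by move=> u v ue ve; exact: norm2D_le.
Qed.

(** The valuation takes integer values, so no absolute value lies strictly between 1/2 and 1. *)
Lemma norm2_lt1 u : N2 u < 1 -> N2 u <= 2%:R^-1.
Proof.
have [-> _|u0] := eqVneq u 0; first by rewrite norm2_0 invr_ge0 ler0n.
rewrite /norm2 (negPf u0); case: (v2 u) => [[|k]|k].
- by rewrite oppr0 expr0z ltxx.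
- rewrite -invr_expz -exprnP => _; rewrite lef_pV2 ?posrE ?exprn_gt0 //.
  by rewrite exprS ler_peMr // exprn_ege1 ?ler1n.
- by rewrite NegzE opprK lt_gtF // exprn_egt1 ?ltr1n.
Qed.

Lemma norm2_lt1E u : (N2 u < 1) = (u == 0) || (0 < v2 u).
Proof.
have [->|u0] := eqVneq u 0; first by rewrite norm2_0 ltr01.
rewrite /norm2 (negPf u0) /=; case: (v2 u) => [[|k]|k].
- by rewrite oppr0 expr0z !ltxx.
- by rewrite -invr_expz -exprnP invf_lt1 ?exprn_gt0 // exprn_egt1 ?ltr1n.
- by rewrite NegzE opprK lt_gtF // exprn_egt1 ?ltr1n.
Qed.
End Norm2.

(** * Dyadic rationals and the 2-adic integral part *)

Section Dyadic.
Variables (F : realFieldType) (phi : {rmorphism rat -> Q2}).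
Local Notation N2 := (@norm2 F).

(** The power of 2 whose inverse is the 2-adic absolute value of [n] divides [n], hence is at most
    [n]. *)
Lemma norm2_nat_ge (n : nat) : (0 < n)%N -> 1 <= n%:R * N2 n%:R.
Proof.
move=> n0; have n2 : (n%:R : Z2) != 0.
  (* As [n < 2 ^ n], the number [n] is its own residue modulo [2 ^ n], so it does not vanish in
     [Z2]. *)
  apply/eqP => nE; have := z2trunc_nat n n; rewrite nE (z2trunc_nat 0 n) {nE}.
  rewrite mod0n modn_small; last exact: ltn_expl.
  by move=> n00; rewrite -n00 in n0.
rewrite -[X in N2 X](rmorph_nat (@tofrac Z2)) -[X in N2 X]mul1r
  -[X in N2 (X * _)](expr0z 2%:R).
rewrite norm2_exp2M // oppr0 sub0r -invr_expz ler_pdivlMr ?exprn_gt0 //.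
rewrite mul1r -exprnP -natrX ler_nat dvdn_leq // /dvdn.
have := congr1 (z2trunc^~ (z2val n%:R)) (z2valE n2).
by rewrite z2trunc_nat z2trunc_mul z2trunc_exp2 modnn mul0n mod0n => ->.
Qed.

Definition dyadic (r : rat) := exists (k : nat) (m : int), r * 2%:R ^+ k = m%:~R.

Lemma dyadic_int (m : int) : dyadic m%:~R.
Proof. by exists 0%N, m; rewrite mulr1. Qed.

Lemma dyadicD r s : dyadic r -> dyadic s -> dyadic (r + s).
Proof.
move=> [k [m rE]] [l [n sE]]; exists (k + l)%N, (m * 2 ^+ l + n * 2 ^+ k).
by rewrite mulrDl exprD mulrA rE mulrCA sE !rmorphD !rmorphM !rmorphXn /=; ring.
Qed.

Lemma dyadicM r s : dyadic r -> dyadic s -> dyadic (r * s).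
Proof.
move=> [k [m rE]] [l [n sE]]; exists (k + l)%N, (m * n).
by rewrite exprD mulrACA rE sE rmorphM.
Qed.

Lemma dyadic_sum (I : Type) (s : seq I) (P : pred I) (f : I -> rat) :
  (forall i, dyadic (f i)) -> dyadic (\sum_(i <- s | P i) f i).
Proof.
by move=> df; apply: (big_ind dyadic) => //; [exact: (dyadic_int 0)|exact: dyadicD].
Qed.

Lemma dyadic_floor2 u : dyadic (floor2 u).
Proof.
apply: dyadic_sum => k; exists k, (digits u (- k%:Z))%:Z.
by rewrite -mulrA exprnP -expfzDr // addNr mulr1.
Qed.

(** Powers of 2 cancel between the two absolute values, which leaves a nonzero integer. In the
    Liouville argument this replaces the fact that a nonzero integer has absolute value at least
    1. *)
Lemma dyadic_norm2_ge1 r : dyadic r -> r != 0 -> 1 <= `|ratr r| * N2 (phi r).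
Proof.
move=> [k [m rE]] r0; have p0 : (2%:R ^+ k : rat) != 0 by rewrite expf_neq0.
have m0 : m != 0 by rewrite -(intr_eq0 rat) -rE mulf_neq0.
have -> : r = m%:~R / 2%:R ^+ k by rewrite -rE mulfK.
rewrite !fmorph_div /= !rmorphXn /= !rmorph_nat !rmorph_int.
rewrite norm2M norm2V norm2X norm2_two normrM normfV normrX normr_nat.
rewrite exprVn invrK mulrACA mulVf ?expf_neq0 ?pnatr_eq0 // mulr1.
have := @norm2_nat_ge `|m|%N; rewrite absz_gt0 => /(_ m0).
rewrite natr_absz -intr_norm.
by case: (intP m) => // n; rewrite ?rmorphN /= ?norm2N.
Qed.

Lemma norm2_floor2 u : N2 (u - phi (floor2 u)) <= 2%:R^-1.
Proof.
apply: norm2_lt1; rewrite norm2_lt1E -(norm2_lt1E rat).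
have [low /(_ 1 ltr01)[N0 near]] := digitsP u.
have termE n : phi ((digits u n)%:R * 2%:R ^ n) = (digits u n)%:R * 2%:R ^ n.
  by rewrite rmorphM /= fmorphXz !rmorph_nat.
pose m := `|v2 u|%N.
have [v_gt0|v_le0] := ltP 0 (v2 u).
  have -> : floor2 u = 0.
    rewrite /floor2 big1 // => k _.
    by rewrite low ?mul0r // (le_lt_trans _ v_gt0) // oppr_le0.
  by rewrite rmorph0 subr0 norm2_lt1E v_gt0 orbT.
(* This case includes [u = 0], whose dummy valuation is 0. *)
have vE : v2 u = - m%:Z by rewrite /m; lia.
(* A partial sum at distance less than 1 from [u] is cut after exponent 0: its first [m.+1] terms
   make up [floor2 u], and the others, collected in [s], are divisible by 2. *)
have := near (m.+1 + N0)%N (leq_addl _ _); rewrite big_split_ord /= opprD addrA.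
set s := \sum_(i < N0) _.
have s_le : norm2 s <= 2%:R^-1 :> rat.
  apply: norm2_sum_le => // j _; rewrite norm2M norm2_exp2.
  have -> : v2 u + (m.+1 + j)%N = j.+1 by rewrite vE; lia.
  case: (digits _ _); rewrite ?norm2_0 ?mul0r // norm2_1 mul1r.
  rewrite -invr_expz lef_pV2 ?posrE ?exprn_gt0 //.
  by rewrite -exprnP exprS ler_peMr // exprn_ege1.
suff -> : \sum_(i < m.+1) (digits u (v2 u + i))%:R * 2 ^ (v2 u + i) = phi (floor2 u).
  move=> /norm2_lt1 le_half; rewrite -[_ - _](subrK s).
  by apply: le_lt_trans (norm2D_le le_half s_le) _.
rewrite /floor2 rmorph_sum (reindex_inj rev_ord_inj) /=; apply: eq_bigr => i _.
rewrite termE; have le_im : (i <= m)%N := ltn_ord i.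
by have -> : v2 u + (m.+1 - i.+1)%N = - i%:Z by rewrite vE subSS -subzn //; lia.
Qed.
End Dyadic.

(** * Growth of the denominators *)

(* The index of x is shifted: x n stands for x_(n+1), hence the parity in x_small. *)
Section Growth.
Variables (R : realFieldType) (x q Q : nat -> R).
Local Notation t n := ((1 + tau n)%:R : R).
Hypothesis x_small : forall n, t n * `|x n| < 1.
Hypotheses (q0 : q 0 = 1) (Q0 : Q 0 = 1).
Hypothesis QS : forall n, Q n = Q n.+1 * x n.
Hypothesis qS : forall n, q n.+1 = Q n.+1 - q n * x n.+1.

Let tt n : t n * t n.+1 = 2.
Proof. by rewrite /tau /= -natrM; case: odd. Qed.

Let t_gt0 n : 0 < t n.
Proof. by rewrite ltr0n. Qed.

Let Q_gt0 n : 0 < `|Q n|.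
Proof.
elim: n => [|n]; first by rewrite Q0 normr1.
by rewrite !normr_gt0 QS; apply: contra_neq => ->; rewrite mul0r.
Qed.

Let QSn n : `|Q n| = `|Q n.+1| * `|x n|.
Proof. by rewrite QS normrM. Qed.

Let Q1_ge1 : 1 <= `|Q 1|.
Proof.
have := QSn 0; have := x_small 0; have := Q_gt0 1; have := normr_ge0 (x 0).
rewrite Q0 normr1 mul1r; nra.
Qed.

(** The deficit [2^-1 ^+ n] halves at each step. Indeed [t n.+1 * |q n.+1|] is at most
    [|Q n.+2| + |q n|], and since [t n * t n.+1 = 2] the induction hypothesis bounds [2 * |q n|] by
    [(2 - 2^-1 ^+ n) * |Q n.+2|]. *)
Lemma conv_den_le n : t n * `|q n| <= (2 - 2^-1 ^+ n) * `|Q n.+1|.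
Proof.
elim: n => [|n IHn].
  rewrite q0 normr1 expr0 (_ : 2 - 1 = 1 :> R); last by ring.
  by rewrite mulr1 mul1r.
have Ty := x_small n.+1; have TS := tt n; have T0 := t_gt0 n.+1; have S0 := t_gt0 n.
have W0 := Q_gt0 n.+2; have y0 := normr_ge0 (x n.+1); have qn0 := normr_ge0 (q n).
have e0 : 0 <= 2^-1 ^+ n :> R by rewrite exprn_ge0 ?invr_ge0.
have e1 : 2^-1 ^+ n <= 1 :> R by rewrite exprn_ile1 ?invr_ge0 ?invf_le1 ?ler1n.
have le_q : `|q n.+1| <= `|Q n.+2| * `|x n.+1| + `|q n| * `|x n.+1|.
  by rewrite qS -QSn -normrM ler_normB.
move: IHn; rewrite QSn exprS.
move: `|q n.+1| `|q n| `|x n.+1| `|Q n.+2| (t n) (t n.+1) (2^-1 ^+ n)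
  Ty TS T0 S0 W0 y0 qn0 e0 e1 le_q.
move=> q1 qn y W S T e Ty TS T0 S0 W0 y0 qn0 e0 e1 le_q IHn.
have le2 : 2 * qn <= T * ((2 - e) * (W * y)).
  by rewrite (_ : 2 * qn = T * (S * qn)) ?ler_pM2l // -TS mulrCA mulrA.
have le3 : T * q1 <= (T * y) * (W + qn) by nra.
have p0 : 0 <= (2 - e) * W by rewrite mulr_ge0 ?subr_ge0 ?ltW //; lra.
have Ty1 : 0 <= 1 - T * y by lra.
have le4 : 2 * qn <= (2 - e) * W by have := mulr_ge0 Ty1 p0; lra.
have := mulr_ge0 Ty1 (addr_ge0 (ltW W0) qn0).
lra.
Qed.

Lemma conv_den_lt n : t n * `|q n| < 2 * `|Q n.+1|.
Proof.
apply: le_lt_trans (conv_den_le n) _.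
by rewrite ltr_pM2r // gtrBl exprn_gt0 ?invr_gt0.
Qed.

(** One step divides this product by [|x n| * |x n.+1|], which is at most 1/2 since
    [t n * t n.+1 = 2]. *)
Let Q_mul_ge n : 2 ^+ n <= `|Q n| * `|Q n.+1|.
Proof.
elim: n => [|n IHn].
  by rewrite Q0 normr1 mul1r expr0 Q1_ge1.
have := x_small n; have := x_small n.+1; have := tt n.
have := normr_ge0 (x n); have := normr_ge0 (x n.+1).
have := Q_gt0 n.+2; have := t_gt0 n; have := t_gt0 n.+1; move: IHn.
rewrite exprS (QSn n) (QSn n.+1).
move: `|x n.+1| `|x n| `|Q n.+2| (t n) (t n.+1) (2 ^+ n).
move=> y z W S T f le_f T0 S0 W0 y0 z0 ST Ty Sz.
have yz : 2 * (y * z) <= 1.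
  rewrite (_ : 2 * (y * z) = (T * y) * (S * z)); last by rewrite -ST; ring.
  by apply: mulr_ile1; rewrite ?mulr_ge0 // ltW.
have : 0 <= (1 - 2 * (y * z)) * (W * y * W).
  by rewrite !mulr_ge0 ?subr_ge0 // ltW.
lra.
Qed.

(** By [conv_den_le], after subtraction of [q n * x n.+1] from [Q n.+1] at least the fraction
    [2^-1 ^+ n.+1] of [|Q n.+1|] remains in [|q n.+1|]. The lower bound [2 ^+ n.+1] on
    [|Q n.+1| * |Q n.+2|] exactly offsets this loss. *)
Lemma conv_den_ge n : 1 <= `|q n| * `|Q n.+1|.
Proof.
case: n => [|n]; first by have := Q_mul_ge 0; rewrite q0 Q0 expr0.
have := Q_mul_ge n.+1; have := conv_den_le n; have Ty := x_small n.+1; have TS := tt n.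
have T0 := t_gt0 n.+1; have S0 := t_gt0 n.
have W0 := Q_gt0 n.+1; have W2 := Q_gt0 n.+2; have y0 := normr_ge0 (x n.+1).
have ee : 2^-1 ^+ n * 2 ^+ n = 1 :> R by rewrite -exprMn mulVf ?expr1n ?pnatr_eq0.
have e0 : 0 < 2^-1 ^+ n :> R by rewrite exprn_gt0 ?invr_gt0.
have e1 : 2^-1 ^+ n <= 1 :> R by rewrite exprn_ile1 ?invr_ge0 ?invf_le1 ?ler1n.
have ge_q : `|Q n.+1| - `|q n| * `|x n.+1| <= `|q n.+1|.
  by rewrite qS -normrM lerB_dist.
rewrite exprS.
move: `|q n.+1| `|q n| `|x n.+1| `|Q n.+2| `|Q n.+1| (t n) (t n.+1) (2^-1 ^+ n)
  (2 ^+ n) Ty TS T0 S0 W0 W2 y0 ee e0 e1 ge_q.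
move=> q1 qn y W2 W S T e f Ty TS T0 S0 W0 W20 y0 ee e0 e1 ge_q le_q le_WW.
have le2 : 2 * qn <= T * ((2 - e) * W).
  by rewrite (_ : 2 * qn = T * (S * qn)) ?ler_pM2l // -TS mulrCA mulrA.
have p0 : 0 <= (2 - e) * W by rewrite mulr_ge0 ?subr_ge0 ?ltW //; lra.
have Ty1 : 0 <= 1 - T * y by lra.
have := mulr_ge0 Ty1 p0; have := ler_wpM2r y0 le2 => le3 le4.
have le5 : 0 <= 2 * q1 - e * W by lra.
have := mulr_ge0 le5 (ltW W20).
have := ler_wpM2l (ltW e0) le_WW.
lra.
Qed.
End Growth.

(** * 2-adic size of the denominators *)

Section Norm2Den.
Variables (F : numFieldType) (q c : nat -> Q2).
Local Notation N2 := (@norm2 F).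
Hypotheses (q0 : q 0 = 1) (q1 : q 1 = c 0).
Hypothesis qSS : forall n, q n.+2 = c n.+1 * q n.+1 + q n.
Hypothesis c_big : forall n, 1 < N2 (c n) * N2 (c n.+1).

(** By induction [c n.+1 * q n.+1] has the norm of [c n.+1 * c n * q n], larger than that of [q n],
    so it alone decides the norm of the sum. The hypothesis is on products of neighbours because a
    single coefficient may have norm 1. *)
Lemma norm2_conv_denS n : q n != 0 /\ N2 (q n.+1) = N2 (c n) * N2 (q n).
Proof.
have c0 m : 0 < N2 (c m).
  rewrite norm2_gt0; apply: contraTneq (c_big m) => ->.
  by rewrite norm2_0 mul0r ltr10.
elim: n => [|n [qn0 IHn]].
  by rewrite q0 oner_neq0 q1 norm2_1 mulr1.
have qS0 : q n.+1 != 0 by rewrite -(norm2_gt0 F) IHn mulr_gt0 // norm2_gt0.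
split=> //; rewrite qSS norm2D_eq ?norm2M // IHn mulrA [N2 (c n.+1) * _]mulrC.
by rewrite ltr_pMl ?c_big ?norm2_gt0.
Qed.
End Norm2Den.

(** * Convergents *)

Lemma conv_mxS (a : nat -> rat) n i :
  conv_mx a n.+1 i 0 = conv_mx a n i 1 /\
  conv_mx a n.+1 i 1 = conv_mx a n i 0 + a n.+1 * conv_mx a n i 1.
Proof.
have lift01 : lift 0 0 = 1 :> 'I_2 by apply: val_inj.
rewrite /conv_mx big_nat_recr //= -/(conv_mx a n) !mxE !big_ord_recl !big_ord0.
by rewrite !mxE /= lift01; split; ring.
Qed.

Lemma conv_mx0 (a : nat -> rat) :
  [/\ conv_mx a 0 0 0 = 1, conv_mx a 0 0 1 = 0, conv_mx a 0 1 0 = 0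
    & conv_mx a 0 1 1 = 1].
Proof. by rewrite /conv_mx big_geq // !mxE. Qed.

Lemma conv_qSS a n : conv_q a n.+2 = a n.+2 * conv_q a n.+1 + conv_q a n.
Proof.
by rewrite /conv_q (conv_mxS a n.+1 1).2 (conv_mxS a n 1).1 addrC.
Qed.

Lemma conv_q1 a : conv_q a 1 = a 1%N.
Proof.
rewrite /conv_q (conv_mxS a 0 1).2; case: (conv_mx0 a) => _ _ -> ->.
by rewrite add0r mulr1.
Qed.

Lemma dyadic_conv_mx a n i j : (forall k, dyadic (a k)) -> dyadic (conv_mx a n i j).
Proof.
move=> da; elim: n i j => [|n IHn] i j.
  rewrite /conv_mx big_geq // mxE.
  by case: eqP => _; [exact: (dyadic_int 1) | exact: (dyadic_int 0)].
have [/= E0 E1] := conv_mxS a n i; have [->|->] : j = 0 \/ j = 1.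
  by case: j => [[|[|//]] lti]; [left | right]; apply: val_inj.
  by rewrite E0.
by rewrite E1; apply: dyadicD => //; apply: dyadicM.
Qed.

Section Convergents.
Variables (K : fieldType) (iota : {rmorphism rat -> K}).
Variables (alpha : K) (x : nat -> K) (a : nat -> rat).
Hypothesis x0 : x 0 = alpha.
Hypothesis x_neq0 : forall n, x n != 0.
Hypothesis xS : forall n, x n.+1 = (x n)^-1 - iota (a n.+1).

(* conv_lin 0 n = p_n + p_(n-1) x_(n+1) and conv_lin 1 n = Q_n, with x n = x_(n+1). *)
Definition conv_lin (i : 'I_2) n : K :=
  iota (conv_mx a n i 1) + iota (conv_mx a n i 0) * x n.

Local Notation p n := (iota (conv_p a n)).
Local Notation q n := (iota (conv_q a n)).
Local Notation P := (conv_lin 0).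
Local Notation Q := (conv_lin 1).

(** Rests on [x n * (iota (a n.+1) + x n.+1) = 1]. *)
Lemma conv_linS i n : conv_lin i n = conv_lin i n.+1 * x n.
Proof.
rewrite /conv_lin (conv_mxS a n i).1 (conv_mxS a n i).2 xS.
rewrite rmorphD rmorphM /=; field; exact: x_neq0.
Qed.

(** Passing from [n] to [n.+1] divides [P] and [Q] by the same factor [x n], so their ratio keeps
    its initial value [x 0 = alpha]. *)
Lemma conv_lin_pq n : P n = alpha * Q n.
Proof.
elim: n => [|n IHn].
  rewrite /conv_lin; case: (conv_mx0 a) => -> -> -> ->.
  by rewrite x0 rmorph0 rmorph1; ring.
by apply: (mulIf (x_neq0 n)); rewrite -mulrA -!conv_linS.
Qed.

Lemma conv_den0 : Q 0 = 1.
Proof.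
rewrite /conv_lin; case: (conv_mx0 a) => _ _ -> ->.
by rewrite rmorph0 rmorph1 mul0r addr0.
Qed.

Lemma conv_denS n : q n.+1 = Q n.+1 - q n * x n.+1.
Proof. by rewrite /conv_lin (conv_mxS a n 1).1 addrK. Qed.

Definition conv_err n : K := p n - alpha * q n.

Lemma conv_err0 : conv_err 0 = - x 0.
Proof. by rewrite /conv_err conv_p0 conv_q0 rmorph0 rmorph1 x0 mulr1 sub0r. Qed.

Lemma conv_errS n : conv_err n.+1 = - (conv_err n * x n.+1).
Proof.
have pS : p n.+1 = P n.+1 - p n * x n.+1.
  by rewrite /conv_lin (conv_mxS a n 0).1 addrK.
rewrite /conv_err pS conv_denS conv_lin_pq; ring.
Qed.

Lemma conv_err_den n : conv_err n * Q n.+1 = (-1) ^+ n.+1.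
Proof.
elim: n => [|n IHn].
  by rewrite conv_err0 mulNr mulrC -conv_linS conv_den0 expr1.
by rewrite conv_errS mulNr -mulrA [x _ * _]mulrC -conv_linS IHn [RHS]exprS mulN1r.
Qed.
End Convergents.

(** * One step of the algorithm *)

Section Step.
Variables (R : realType) (K : fieldExtType rat).
Variables (soo : {rmorphism K -> R}) (s2 : {rmorphism K -> Q2}).
Implicit Types x : K.
Local Notation N2 := (@norm2 R).
Local Notation phi := (s2 \o GRing.in_alg K).

Lemma s2_alg r : s2 r%:A = ratr r.
Proof. by rewrite alg_num_field fmorph_rat. Qed.

Lemma soo_alg r : soo r%:A = ratr r.
Proof. by rewrite alg_num_field fmorph_rat. Qed.

Lemma least_argmin_le (t d y : R) : 0 < d ->
  2 * `|t - d * (least_argmin (fun i => `|t - d * i%:~R - y|))%:~R - y| <= d.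
Proof.
move=> d0; have [min _] := least_argminP t y d0; move: (least_argmin _) min => m min.
set w := t - _ - y.
(* Minimality, tested against the neighbours [m - 1] and [m + 1] only, already confines [w] to half
   a step. *)
have : `|w| <= `|w + d|.
  by have := min (m - 1); rewrite intrB mulrBr mulr1 /w; congr (_ <= `|_|); ring.
have : `|w| <= `|w - d|.
  by have := min (m + 1); rewrite intrD mulrDr mulr1 /w; congr (_ <= `|_|); ring.
by case: (ler0P w); case: (ler0P (w - d)); case: (ler0P (w + d)); lra.
Qed.

(** Treats both parities at once: the admissible quotients have spacing [2 - eps], and half of that
    is [1 / (1 + eps)] for [eps] equal to 0 or 1. *)
Lemma quotE (eps : bool) x : exists2 m : int,
  quot soo s2 eps x = (2 - eps%:R) * m%:~R + floor2 (s2 x^-1) &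
  (1 + eps)%:R * `|soo x^-1 - ratr (quot soo s2 eps x)| <= 1.
Proof.
rewrite /quot; case: eps => /=.
  rewrite /quot1; set m := least_argmin _; exists m.
    by rewrite (_ : 2 - 1 = 1 :> rat) ?mul1r //; ring.
  have := @least_argmin_le (soo x^-1) 1 (ratr (floor2 (s2 x^-1))) ltr01.
  rewrite (_ : least_argmin _ = m) ?mul1r; last first.
    by congr least_argmin; apply/funext => i; rewrite mul1r.
  by rewrite rmorphD /= ratr_int opprD addrA.
rewrite /quot0; set m := least_argmin _; exists m; first by rewrite subr0.
have := @least_argmin_le (soo x^-1) 2 (ratr (floor2 (s2 x^-1))) (ltr0Sn R 1).
rewrite -/m rmorphD rmorphM /= ratr_int ratr_nat opprD addrA; lra.
Qed.

(** 2-adically the remainder is the fractional part, of norm at most 1/2, minus [(2 - eps) * m], of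
    norm at most 1/2 or 1. The bounds thus gain a factor 2 at the 2-adic place when [eps] is 0 and
    at the real place when it is 1. *)
Lemma T2_bounds (eps : bool) x :
  (1 + eps)%:R * `|soo (T2 soo s2 eps x)| <= 1 /\
  2 * N2 (s2 (T2 soo s2 eps x)) <= (1 + eps)%:R.
Proof.
have [m quotE le1] := quotE eps x; split.
  by rewrite rmorphB /= fmorph_rat.
rewrite /T2 -alg_num_field rmorphB /= quotE -[s2 _%:A]/(phi _) rmorphD opprD addrCA.
rewrite mulrC -ler_pdivlMr //; apply: norm2D_le.
  rewrite norm2N rmorphM norm2M rmorphB !rmorph_nat rmorph_int.
  have := norm2_int R m; have := norm2_ge0 R m%:~R.
  case: (eps) => /= N0 N1; last by rewrite subr0 norm2_two; lra.
  by rewrite (_ : 2 - 1 = 1 :> Q2) ?norm2_1; [lra | rewrite -[2]/(1 + 1) addrK].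
apply: le_trans (norm2_floor2 R phi _) _.
by rewrite ler_pdivlMr // mulVf ?pnatr_eq0 // ler1n.
Qed.

Lemma irrational_lt (k : nat) x :
  x \notin 1%VS -> k%:R * `|soo x| <= 1 -> k%:R * `|soo x| < 1.
Proof.
move=> irr; rewrite le_eqVlt => /predU1P[eq1|//].
case/negP: irr; have k0 : (k%:R : rat) != 0.
  rewrite pnatr_eq0; apply: contra_eq_neq eq1 => ->.
  by rewrite mul0r eq_sym oner_eq0.
(* Equality forces [k%:R * soo x] to be 1 or -1, which would make [x] rational. *)
have : (k%:R * soo x) ^+ 2 = 1.
  by rewrite -[LHS]ger0_norm ?sqr_ge0 // normrX normrM normr_nat eq1 expr1n.
have E r : k%:R * soo x = ratr r -> x \in 1%VS.
  move=> kx; apply/vlineP; exists (k%:R^-1 * r); apply: (fmorph_inj soo).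
  rewrite soo_alg rmorphM fmorphV /= ratr_nat -kx mulKf //.
  by rewrite pnatr_eq0 -(pnatr_eq0 rat).
move/eqP; rewrite sqrf_eq1 => /orP[] /eqP kx; [apply: (E 1) | apply: (E (-1))].
  by rewrite rmorph1.
by rewrite rmorphN1.
Qed.

End Step.

(** * Liouville's inequality at both places *)

(** As [alpha] is irrational, 1 and [alpha] span the two-dimensional space [K]. *)
Lemma quadratic_relation (K : fieldExtType rat) (alpha : K) :
  \dim {: K} = 2%N -> alpha \notin 1%VS ->
  exists b c : rat, alpha ^+ 2 = b%:A * alpha + c%:A.
Proof.
move=> dimK irr; pose V := (1 + <[alpha]>)%VS.
have VE : V = fullv.
  apply/eqP; rewrite eqEdim subvf dimK /=.
  have : (1 <= V)%VS := addvSl _ _.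
  move=> /dimv_leqif_sup/ltn_leqif; rewrite dimv1 => ->.
  rewrite -[in X in ~~ X]/V; apply: contra irr => /subvP; apply.
  by rewrite /V -[alpha]add0r memv_add ?mem0v // add0r memv_line.
have : alpha ^+ 2 \in V by rewrite VE memvf.
case/memv_addP => _ /vlineP[c ->] [_ /vlineP[b ->] E].
by exists b, c; rewrite E addrC mulr_algl.
Qed.

(** The left side is the norm form of [p - alpha * q], the conjugate of [alpha] being
    [iota b - alpha]. *)
Lemma quadratic_form_factor (K : fieldType) (iota : {rmorphism rat -> K})
    (alpha : K) (b c p q : rat) :
  alpha ^+ 2 = iota b * alpha + iota c -> q != 0 ->
  iota (p ^+ 2 - b * (p * q) - c * q ^+ 2)
  = iota q ^+ 2 * ((alpha - iota (p / q)) * (iota b - alpha - iota (p / q))).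
Proof.
move=> alpha2 q0; have iq0 : iota q != 0 by rewrite fmorph_eq0.
rewrite !expr2 !rmorphB fmorph_div !rmorphM.
have -> : iota c = alpha ^+ 2 - iota b * alpha by rewrite alpha2 addrC addKr.
by field.
Qed.

Section Liouville.
Local Notation N2 := (@norm2 _).

Lemma quadratic_liouville (R : realType) (K : fieldExtType rat)
    (soo : {rmorphism K -> R}) (s2 : {rmorphism K -> Q2}) (alpha : K) :
  \dim {: K} = 2%N -> alpha \notin 1%VS ->
  exists2 C : R, 0 < C & forall p q : rat, dyadic p -> dyadic q -> q != 0 ->
    `|soo alpha - ratr (p / q)| <= 1 -> norm2 (s2 alpha - ratr (p / q)) <= 1 :> R ->
    C / (norm2 (ratr q) * `|ratr q|) ^+ 2
      < `|soo alpha - ratr (p / q)| * norm2 (s2 alpha - ratr (p / q)).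
Proof.
move=> dimK irr; have [b [c alpha2]] := quadratic_relation dimK irr.
pose beta : K := b%:A - alpha.
(* [d] clears the denominators of [b] and [c], so that [w] below is dyadic; [D] is the price paid
   for it at both places. *)
pose d : int := denq b * denq c.
have d0 : d != 0 by rewrite mulf_neq0 ?denq_neq0.
pose D : R := `|ratr d%:~R| * N2 (s2 d%:~R%:A).
(* [M1] and [M2] bound the conjugate factor: [beta - z] differs from [alpha - z], of size at most 1,
   by the constant [beta - alpha]. *)
pose M1 : R := 1 + `|soo beta - soo alpha|.
pose M2 : R := 1 + N2 (s2 beta - s2 alpha).
have D0 : 0 < D.
  rewrite mulr_gt0 // ?normr_gt0 ?norm2_gt0 -?in_algE ?fmorph_eq0 ?intr_eq0 //.
have M10 : 0 < M1 by rewrite ltr_wpDr ?normr_ge0 ?ltr01.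
have M20 : 0 < M2 by rewrite ltr_wpDr ?norm2_ge0 ?ltr01.
have c0 : 0 < 2 * (D * (M1 * M2)) by do 3![apply: mulr_gt0 => //].
(* The factor 2 makes the resulting inequality strict. *)
exists (2 * (D * (M1 * M2)))^-1; first by rewrite invr_gt0.
move=> p q dp dq q0; pose z := p / q => delta1 eps1.
pose f := p ^+ 2 - b * (p * q) - c * q ^+ 2; pose w := d%:~R * f.
have fE : f%:A = q%:A ^+ 2 * ((alpha - z%:A) * (beta - z%:A)).
  exact: (quadratic_form_factor (iota := GRing.in_alg K) p alpha2 q0).
(* The form could vanish only if the rational [z] were [alpha] or its conjugate, both irrational. *)
have irr_z : z%:A != alpha by apply: contraNneq irr => <-; rewrite memvZ ?memv_line.
have irr_z' : z%:A != beta.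
  apply: contraNneq irr => zb; rewrite (_ : alpha = b%:A - z%:A).
    by rewrite memvB ?memvZ ?memv_line.
  by rewrite zb /beta opprB addrC subrK.
have w0 : w != 0.
  rewrite mulf_neq0 ?intr_eq0 //; apply/eqP => f0.
  move/eqP: fE; rewrite f0 scale0r eq_sym mulf_eq0 expf_eq0 /= mulf_eq0 !subr_eq0.
  rewrite -in_algE fmorph_eq0 (negPf q0) /= !(eq_sym _ (_%:A)).
  by rewrite (negPf irr_z) (negPf irr_z').
have dw : dyadic w.
  rewrite (_ : w = d%:~R * (p * p) + ((- numq b * denq c)%:~R * (p * q)
                   + (- numq c * denq b)%:~R * (q * q))).
    by do !apply: dyadicD; do !apply: dyadicM => //; apply: dyadic_int.
  by rewrite /w /f !rmorphM !rmorphN /= !numqE; ring.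
have ge1 : 1 <= D * (N2 (ratr q) * `|ratr q|) ^+ 2
    * (`|soo alpha - ratr z| * N2 (s2 alpha - ratr z)
       * (`|soo beta - ratr z| * N2 (s2 beta - ratr z))).
  have wE : w%:A = d%:~R%:A * f%:A :> K by rewrite -!in_algE rmorphM.
  have ge1 : 1 <= `|ratr w| * N2 (s2 w%:A) :> R.
    exact: (@dyadic_norm2_ge1 R (s2 \o GRing.in_alg K) w dw w0).
  apply: le_trans ge1 _.
  have key (L : fieldType) (s : {rmorphism K -> L}) : s w%:A
      = s d%:~R%:A * (s q%:A ^+ 2 * ((s alpha - s z%:A) * (s beta - s z%:A))).
    rewrite wE fE; move: (beta) (d%:~R%:A) (q%:A) (z%:A) => y1 y2 y3 y4.
    by rewrite !expr2 !rmorphM !rmorphB.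
  have -> : ratr w = soo w%:A by rewrite soo_alg.
  rewrite !key /D !soo_alg !s2_alg.
  move: (ratr d%:~R : R) (ratr d%:~R : Q2) (ratr q : R) (ratr q : Q2) => d1 d2 q1 q2.
  move: (soo _ - _) (s2 _ - _) (soo _ - _) (s2 _ - _) => u1 u2 v1 v2.
  rewrite !(normrM, norm2M, normrX, norm2X) le_eqVlt; apply/orP; left; apply/eqP.
  by ring.
have le1 : `|soo beta - ratr z| <= M1.
  have -> : soo beta - ratr z = soo alpha - ratr z + (soo beta - soo alpha) by ring.
  by apply: le_trans (ler_normD _ _) _; rewrite lerD2r.
have le2 : N2 (s2 beta - ratr z) <= M2.
  have -> : s2 beta - ratr z = s2 alpha - ratr z + (s2 beta - s2 alpha) by ring.
  by apply: norm2D_le; [apply: ler_wpDr (norm2_ge0 _ _) eps1 | rewrite lerDr].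
have h0 : 0 < (N2 (ratr q) * `|ratr q|) ^+ 2 :> R.
  rewrite exprn_gt0 // mulr_gt0 // ?normr_gt0 ?fmorph_eq0 //.
  by rewrite norm2_gt0 -(s2_alg s2) fmorph_eq0 -in_algE fmorph_eq0.
have := ler_pM (normr_ge0 _) (norm2_ge0 _ _) le1 le2.
have : 0 <= `|soo alpha - ratr z| * N2 (s2 alpha - ratr z) by rewrite mulr_ge0 ?norm2_ge0.
move: ge1 h0; set h := _ ^+ 2; set e := `|soo alpha - _| * _.
set e' := _ * N2 (s2 beta - _).
move=> ge1 h0 e0 le3.
rewrite -invfM -[X in X < _]mul1r ltr_pdivrMr; last exact: mulr_gt0.
have := ler_wpM2l (mulr_ge0 (ltW (mulr_gt0 D0 h0)) e0) le3.
lra.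
Qed.

End Liouville.

Lemma ratr1_Q2 : ratr 1 = 1 :> Q2.
Proof. exact: (ratr_nat _ 1). Qed.

(** * Complete quotients *)

Section Tails.
Variables (R : realType) (K : fieldExtType rat).
Variables (soo : {rmorphism K -> R}) (s2 : {rmorphism K -> Q2}) (alpha : K).
Hypotheses (irrational_alpha : alpha \notin 1%VS) (alphaI : propertyI soo s2 alpha).
Local Notation N2 := (@norm2 R).
Local Notation x n := (cf_tail soo s2 alpha n.+1).
Local Notation a := (cf_quot soo s2 alpha).
Local Notation t n := ((1 + tau n)%:R : R).

Lemma cf_tailS n : x n.+1 = (x n)^-1 - (a n.+1)%:A.
Proof. by rewrite alg_num_field. Qed.

Lemma dyadic_cf_quot n : dyadic (a n).
Proof.
rewrite /cf_quot; have [m -> _] := quotE soo s2 (odd n) (cf_tail soo s2 alpha n).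
apply: dyadicD; last exact: dyadic_floor2.
by have := dyadic_int ((2 - (odd n)%:R) * m); rewrite rmorphM rmorphB !rmorph_nat.
Qed.

Lemma cf_tail_irrational n : x n \notin 1%VS.
Proof.
elim: n => [//|n]; apply: contra; rewrite cf_tailS => xS.
rewrite -[x n]invrK (_ : (x n)^-1 = x n.+1 + (a n.+1)%:A); last by rewrite cf_tailS subrK.
have /vlineP[r ->] : x n.+1 + (a n.+1)%:A \in 1%VS.
  by rewrite memvD // ?cf_tailS // memvZ ?memv_line.
by rewrite -in_algE -fmorphV memvZ ?memv_line.
Qed.

Lemma cf_tail_neq0 n : x n != 0.
Proof. by apply: contraNneq (cf_tail_irrational n) => ->; rewrite mem0v. Qed.

(** Property I for the first tail and the one-step bound for the later ones give the weak
    inequality; irrationality makes it strict. *)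
Lemma cf_tail_real n : t n * `|soo (x n)| < 1.
Proof.
apply: irrational_lt (cf_tail_irrational n) _; case: n => [|n].
  by case: alphaI => /andP[gtN1 le1] _; rewrite mul1r ler_norml ltW.
exact: (T2_bounds soo s2 (odd n.+1) (x n)).1.
Qed.

Lemma cf_tail_norm2 n : 2 * N2 (s2 (x n)) <= t n.
Proof.
case: n => [|n]; last exact: (T2_bounds soo s2 (odd n.+1) (x n)).2.
have : N2 (s2 alpha) < 1 by rewrite norm2_lt1E alphaI.2 orbT.
by move/norm2_lt1; rewrite -[t 0]/(1 : R) /=; lra.
Qed.

(** A single tail is only known to have norm at most 1 or 1/2, according to parity; of two
    neighbours, one has the better bound. *)
Lemma cf_tail_norm2M n : N2 (s2 (x n)) * N2 (s2 (x n.+1)) <= 2^-1.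
Proof.
have tt : t n * t n.+1 = 2 by rewrite /tau /= -natrM; case: odd.
have N0 := norm2_ge0 R (s2 (x n)); have N1 := norm2_ge0 R (s2 (x n.+1)).
have := ler_pM _ _ (cf_tail_norm2 n) (cf_tail_norm2 n.+1).
by rewrite tt !mulr_ge0 // => /(_ isT isT); lra.
Qed.

(** [a n.+1] is the inverse of [x n] minus [x n.+1], and the inverse dominates because
    [x n * x n.+1] has norm below 1. *)
Lemma cf_quot_norm2 n : N2 (ratr (a n.+1)) * N2 (s2 (x n)) = 1.
Proof.
have Nx : 0 < N2 (s2 (x n)) by rewrite norm2_gt0 fmorph_eq0 cf_tail_neq0.
have Nxn : 0 < N2 (s2 (x n.+1)) by rewrite norm2_gt0 fmorph_eq0 cf_tail_neq0.
have aE : ratr (a n.+1) = (s2 (x n))^-1 - s2 (x n.+1).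
  by rewrite cf_tailS rmorphB fmorphV s2_alg opprB addrC subrK.
rewrite aE norm2D_eq norm2V ?mulVf ?gt_eqF // norm2N.
rewrite -(ltr_pM2l Nx) divff ?gt_eqF //.
by apply: le_lt_trans (cf_tail_norm2M n) _; rewrite invf_lt1 ?ltr1n.
Qed.

Lemma cf_quot_neq0 n : ratr (a n.+1) != 0 :> Q2.
Proof.
apply: contraPneq (cf_quot_norm2 n) => ->.
by rewrite norm2_0 mul0r => /eqP; rewrite eq_sym oner_eq0.
Qed.

Lemma cf_quot_norm2_ge1 n : 1 <= N2 (ratr (a n.+1)).
Proof.
have Nx : 0 < N2 (s2 (x n)) by rewrite norm2_gt0 fmorph_eq0 cf_tail_neq0.
have le1 : N2 (s2 (x n)) <= 1.
  rewrite -(ler_pM2l (ltr0Sn R 1)) mulr1; apply: le_trans (cf_tail_norm2 n) _.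
  by rewrite ler_nat /tau; case: odd.
by rewrite -(ler_pM2r Nx) mul1r cf_quot_norm2.
Qed.

Lemma cf_quot_norm2_gt1 n : 1 < N2 (ratr (a n.+1)) * N2 (ratr (a n.+2)).
Proof.
have := cf_tail_norm2M n.
rewrite -(mulr1_eq (cf_quot_norm2 n)) -(mulr1_eq (cf_quot_norm2 n.+1)).
rewrite -invfM lef_pV2 ?posrE ?mulr_gt0 ?norm2_gt0 ?cf_quot_neq0 //.
by apply: lt_le_trans; rewrite ltr1n.
Qed.

Lemma conv_q_norm2 n : conv_q a n != 0 /\
  N2 (ratr (conv_q a n.+1)) = N2 (ratr (a n.+1)) * N2 (ratr (conv_q a n)).
Proof.
have phiE r : ratr r = (s2 \o GRing.in_alg K) r by rewrite (fmorph_eq_rat (s2 \o _)).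
have [||m|m|q0 qS] := @norm2_conv_denS R (fun n => ratr (conv_q a n))
  (fun n => ratr (a n.+1)) _ _ _ _ n.
- by rewrite conv_q0 phiE rmorph1.
- by rewrite conv_q1.
- by rewrite conv_qSS !phiE rmorphD rmorphM.
- exact: cf_quot_norm2_gt1.
by split=> //; move: q0; rewrite phiE fmorph_eq0.
Qed.

Lemma conv_q_norm2_ge1 n : 1 <= N2 (ratr (conv_q a n)).
Proof.
elim: n => [|n IHn]; first by rewrite conv_q0 ratr1_Q2 norm2_1.
by rewrite (conv_q_norm2 n).2 mulr_ege1 ?cf_quot_norm2_ge1.
Qed.

Lemma conv_scaleE n : ratr (conv_scale a n) = N2 (ratr (conv_q a n)) :> R.
Proof.
elim: n => [|n IHn].
  by rewrite /conv_scale big_geq // oppr0 expr0z conv_q0 rmorph1 ratr1_Q2 norm2_1.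
rewrite (conv_q_norm2 n).2 -IHn /conv_scale big_nat_recr //= opprD expfzDr //.
rewrite rmorphM mulrC; congr (_ * _).
by rewrite /norm2 (negPf (cf_quot_neq0 n)) fmorphXz rmorph_nat.
Qed.

Local Notation Q n := (conv_lin (GRing.in_alg K) (fun m => x m) a 1 n).

Lemma conv_real_bounds n :
  t n * `|ratr (conv_q a n)| < 2 * `|soo (Q n.+1)| /\
  1 <= `|ratr (conv_q a n)| * `|soo (Q n.+1)|.
Proof.
have QS m := conv_linS (a := a) (iota := GRing.in_alg K) cf_tail_neq0 cf_tailS 1 m.
have qS m : ratr (conv_q a m.+1) = soo (Q m.+1) - ratr (conv_q a m) * soo (x m.+1).
  rewrite -!(soo_alg soo) -rmorphM -rmorphB; congr (soo _).
  exact: (conv_denS (GRing.in_alg K) (fun m => x m) a m).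
have q0 : ratr (conv_q a 0) = 1 :> R by rewrite conv_q0 rmorph1.
have Q0 : soo (Q 0) = 1 by rewrite conv_den0 rmorph1.
have sQS m : soo (Q m) = soo (Q m.+1) * soo (x m) by rewrite QS rmorphM.
split.
- exact: (conv_den_lt (q := fun m => ratr (conv_q a m)) (Q := fun m => soo (Q m))
    cf_tail_real q0 Q0 sQS qS).
- exact: (conv_den_ge (q := fun m => ratr (conv_q a m)) (Q := fun m => soo (Q m))
    cf_tail_real q0 Q0 sQS qS).
Qed.

Local Notation err n := (conv_err (GRing.in_alg K) alpha a n).

Lemma conv_err_real n : `|soo (err n)| * `|soo (Q n.+1)| = 1.
Proof.
rewrite -normrM -rmorphM (conv_err_den (iota := GRing.in_alg K) (a := a)
  (x := fun n => x n) _ cf_tail_neq0 cf_tailS) //.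
by rewrite rmorphXn rmorphN1 normrX normrN1 expr1n.
Qed.

(** From [n] to [n.+1] the error gains the factor [x n.+1] and the bracket the norm of [a n.+2];
    these cancel by [cf_quot_norm2]. *)
Lemma conv_err_norm2 n :
  N2 (s2 (err n)) * (N2 (ratr (a n.+1)) * N2 (ratr (conv_q a n))) = 1.
Proof.
elim: n => [|n IHn].
  rewrite (conv_err0 (GRing.in_alg K) (x := fun n => x n) a (erefl _)) // rmorphN norm2N.
  by rewrite conv_q0 ratr1_Q2 norm2_1 mulr1 mulrC cf_quot_norm2.
have errS : err n.+1 = - (err n * x n.+1).
  exact: (@conv_errS _ (GRing.in_alg K) _ (fun n => x n) a erefl cf_tail_neq0 cf_tailS n).
have -> : N2 (s2 (err n.+1)) = N2 (s2 (err n)) * N2 (s2 (x n.+1)).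
  by rewrite errS; move: (err n) (x n.+1) => u v; rewrite rmorphN norm2N rmorphM norm2M.
rewrite (conv_q_norm2 n).2 -[RHS](mul1r 1) -{1}IHn -(cf_quot_norm2 n.+1); ring.
Qed.

Lemma conv_errE n : alpha - (conv_p a n / conv_q a n)%:A = - (err n / (conv_q a n)%:A).
Proof.
have q0 : GRing.in_alg K (conv_q a n) != 0 by rewrite fmorph_eq0 (conv_q_norm2 n).1.
by rewrite /conv_err -!in_algE fmorph_div; field.
Qed.

Lemma approx_real n : `|soo alpha - ratr (conv_p a n / conv_q a n)|
  = (`|ratr (conv_q a n)| * `|soo (Q n.+1)|)^-1.
Proof.
rewrite -(soo_alg soo) -rmorphB conv_errE rmorphN normrN fmorph_div normf_div soo_alg.
by rewrite invfM mulrC (mulr1_eq (etrans (mulrC _ _) (conv_err_real n))).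
Qed.

Lemma approx_norm2 n : N2 (s2 alpha - ratr (conv_p a n / conv_q a n))
  = (N2 (ratr (a n.+1)) * N2 (ratr (conv_q a n)) ^+ 2)^-1.
Proof.
rewrite -(s2_alg s2) -rmorphB conv_errE rmorphN norm2N fmorph_div norm2M norm2V s2_alg.
by rewrite expr2 mulrA invfM (mulr1_eq (etrans (mulrC _ _) (conv_err_norm2 n))).
Qed.

End Tails.

(** * Both bounds, assembled from the real and the 2-adic estimates *)

Theorem theorem3p21 (R : realType) (K : fieldExtType rat)
    (quadratic_K : \dim {: K} = 2%N)
    (soo : {rmorphism K -> R}) (s2 : {rmorphism K -> Q2})
    (alpha : K) (irrational_alpha : alpha \notin 1%VS)
    (alphaI : propertyI soo s2 alpha) :
  let a := cf_quot soo s2 alpha in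
  let p' := conv_p' a in
  let q' := conv_q' a in
  exists C : R, 0 < C /\ forall n : nat, (0 < n)%N ->
    C / `|ratr (q' n)| ^+ 2
      < `|soo alpha - ratr (p' n / q' n)| * norm2 (s2 alpha - ratr (p' n / q' n))
      < 2%:R / ((1 + tau n)%:R * norm2 (ratr (a n.+1)) * `|ratr (q' n)| ^+ 2).
Proof.
move=> a p' q'.
have [C C0 lower] := quadratic_liouville soo s2 quadratic_K irrational_alpha.
exists C; split=> // n _.
have [q0 _] := conv_q_norm2 irrational_alpha alphaI n.
have pqE : p' n / q' n = conv_p a n / conv_q a n.
  by rewrite /p' /q' /conv_p' /conv_q' -mulf_div divff ?mul1r // expfz_neq0.
have qE : `|ratr (q' n)| = norm2 (ratr (conv_q a n)) * `|ratr (conv_q a n)| :> R.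
  by rewrite rmorphM normrM /= (conv_scaleE irrational_alpha alphaI) ger0_norm ?norm2_ge0.
have [lt_t ge1] := conv_real_bounds irrational_alpha alphaI n.
have dE := approx_real irrational_alpha alphaI n.
have eE := approx_norm2 irrational_alpha alphaI n.
have Na : 0 < norm2 (ratr (a n.+1)) :> R.
  by rewrite norm2_gt0 (cf_quot_neq0 irrational_alpha alphaI).
have Nq : 0 < norm2 (ratr (conv_q a n)) :> R.
  by rewrite norm2_gt0 -(s2_alg s2) fmorph_eq0 -in_algE fmorph_eq0.
have q_gt0 : 0 < `|ratr (conv_q a n)| :> R by rewrite normr_gt0 fmorph_eq0.
rewrite qE pqE; apply/andP; split.
  (* Liouville's bound applies because the error is at most 1 at both places: at the real place by
     [ge1], at the 2-adic one because the quotients and denominators have norm at least 1. *)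
  apply: lower => //.
  - by apply: dyadic_conv_mx; apply: dyadic_cf_quot.
  - by apply: dyadic_conv_mx; apply: dyadic_cf_quot.
  - by rewrite dE invf_le1 ?(lt_le_trans ltr01).
  rewrite eE invf_le1 ?mulr_gt0 ?exprn_gt0 //.
  by rewrite mulr_ege1 ?exprn_ege1 ?(cf_quot_norm2_ge1 irrational_alpha alphaI)
    ?(conv_q_norm2_ge1 irrational_alpha alphaI).
rewrite dE eE -invfM.
move: lt_t ge1 q_gt0 Nq Na.
move: `|ratr _| (norm2 _) (norm2 _) `|soo _| => g A s G.
move=> lt_t ge1 g0 s0 A0; have G0 : 0 < G.
  by rewrite -(pmulr_rgt0 _ g0) (lt_le_trans ltr01).
rewrite ltr_pdivlMr ?mulr_gt0 ?exprn_gt0 ?mulr_gt0 ?ltr0n // mulrC.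
rewrite ltr_pdivrMr ?mulr_gt0 ?exprn_gt0 //.
(* With denominators cleared, the claim is [lt_t] multiplied by this positive factor. *)
have W0 : 0 < g * A * s ^+ 2 by rewrite !mulr_gt0 ?exprn_gt0.
move: lt_t; rewrite -(ltr_pM2l W0); lra.
Qed.
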